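(* Let $F:D(F)\subseteq\mathcal X\to\mathcal Y$, $f^\dagger$, $g=F(f^\dagger)$, the Hilbert scale $\{\mathcal X_\nu\}_{\nu\in\mathbb R}$ and the indices $a,s,u$ satisfy the Basic Assumption, and let the Conditional Stability Assumption hold with concave index function $\varphi$, constant $R>0$ and admissible set $Q$ (both assumptions are spelled out in the context). For $\delta>0$ let $g^\delta\in\mathcal Y$ satisfy $\|g^\delta-g\|_{\mathcal Y}\le\delta$, and for $\alpha>0$ let $$f_\alpha^\delta\in\operatorname*{argmin}_{f\in D(F)}\left[\tfrac12\|F(f)-g^\delta\|_{\mathcal Y}^2+\alpha\|f\|_s^2\right].$$ Put $\psi_{u,s,a}(t):=\left(\varphi(\sqrt t)\right)^{\frac{2(u-s)}{a+u}}$, $t\ge0$. Fix $r>1$ and consider the candidate parameters $\alpha_1=\delta^2$, $\alpha_j=\alpha_1r^{2j-2}$ for $j=2,\dots,m$, where $m$ is the first index such that $\alpha_m\ge1$. Define $$j_{\mathrm{Lep}}=\max\left\{1\le j\le m:\ \|f_{\alpha_i}^\delta-f_{\alpha_j}^\delta\|_s\le4r^{1-i}\ \text{ for all } i\le j\right\},\qquad \alpha_{\mathrm{Lep}}:=\alpha_{j_{\mathrm{Lep}}}.$$ Suppose that for every sufficiently small $\delta>0$ one has $f_\alpha^\delta\in Q$ for all $\alpha$ in the candidate set $\{\alpha_1,\dots,\alpha_m\}$. Then $$\|f_{\alpha_{\mathrm{Lep}}}^\delta-f^\dagger\|_s=\mathcal O\left(\sqrt{\psi_{u,s,a}(\delta^2)}\right)=\mathcal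 O\left(\left(\varphi(\delta)\right)^{\frac{u-s}{a+u}}\right)\qquad\text{as }\delta\to0.$$
   Context: $\mathcal X$ (norm $\|\cdot\|$) and $\mathcal Y$ (norm $\|\cdot\|_{\mathcal Y}$) are infinite-dimensional separable real Hilbert spaces, $F:D(F)\subseteq\mathcal X\to\mathcal Y$ is a possibly nonlinear operator, and $f^\dagger\in D(F)$ is the unique solution of $F(f)=g$ for the exact right-hand side $g=F(f^\dagger)$ (also written $g^\dagger$). The equation is assumed locally ill-posed at $f^\dagger$: for every $r'>0$ there is a sequence $(f_n)\subset D(F)$ with $\|f_n-f^\dagger\|\le r'$, $\liminf_n\|f_n-f^\dagger\|>0$ and $\|F(f_n)-F(f^\dagger)\|_{\mathcal Y}\to0$. Hilbert scale: $L:D(L)\subset\mathcal X\to\mathcal X$ is a densely defined, closed, unbounded, self-adjoint linear operator that is strictly positive, with $\|Lx\|\ge m_0\|x\|$ for all $x\in D(L)$ and some $m_0>0$. It generates the Hilbert scale $\mathcal X_\nu=D(L^\nu)$, $\nu\in\mathbb R$, $\mathcal X_0=\mathcal X$, with norms $\|x\|_\nu=\|L^\nu x\|$ (for $\nu<0$, completion of $\mathcal X$ in this norm). In the Tikhonov functional $\|f\|_s=\infty$ if $f\notin\mathcal X_s$. Balls: $D_\mu^\nu(\bar f)=\{f\in\mathcal X_\nu:\|f-\bar f\|_\nu\le\mu\}\cap D(F)$. Index function: a continuous, strictly increasing function $\varphi:[0,\infty)\to[0,\infty)$ with $\varphi(0)=0$. Basic Assumption: (a) $D(F)$ is a convex and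 closed subset of $\mathcal X$. (b) $F$ is weak-to-weak sequentially continuous: $x_n\rightharpoonup\bar x$ in $\mathcal X$ with $x_n\in D(F)$ and $\bar x\in D(F)$ implies $F(x_n)\rightharpoonup F(\bar x)$ in $\mathcal Y$. (c) There is $u>0$ with $f^\dagger\in\mathcal X_u$, where $f^\dagger\in D(F)$ is the unique solution of $F(f)=g$. (d) There are indices $a,s\in\mathbb R$ with $a\ge0$, $0\le s<u\le2s+a$ and $-a<s$. Conditional Stability Assumption: there are a concave index function $\varphi$, values $\theta\ge0$, $\rho>0$, $R>0$ and a subset $Q\subseteq D_\rho^\theta(f^\dagger)$ such that $\|f-f^\dagger\|_{-a}\le R\,\varphi(\|F(f)-F(f^\dagger)\|_{\mathcal Y})$ for all $f\in Q$. *)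

(* Defs.v *)
From HB Require Import structures.
From mathcomp Require Import all_boot all_order all_algebra.
From mathcomp Require Import all_classical all_reals all_analysis.

Set Implicit Arguments.
Unset Strict Implicit.
Unset Printing Implicit Defensive.

Import Order.TTheory GRing.Theory Num.Theory.
Import numFieldNormedType.Exports.

Local Open Scope classical_set_scope.
Local Open Scope ring_scope.

HB.mixin Record isInnerProductSpace (R : realType) X
    of CompleteNormedModule R X := {
  inner : X -> X -> R ;
  innerC : forall x y, inner x y = inner y x ;
  inner_linearl : forall (c : R) x y z,
    inner (c *: x + y) z = c * inner x z + inner y z ;
  inner_norm : forall x, inner x x = `|x| ^+ 2
}.

#[short(type="hilbertType")]
HB.structure Definition Hilbert (R : realType) :=
  {X of CompleteNormedModule R X & isInnerProductSpace R X}.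

Definition infinite_dimensional (R : realType) (X : hilbertType R) : Prop :=
  forall (n : nat) (b : 'I_n -> X),
    exists x, forall c : 'I_n -> R, x <> \sum_(i < n) c i *: b i.

Definition separable_space (X : topologicalType) : Prop :=
  exists2 A : set X, countable A & dense A.

Definition weak_cvg (R : realType) (X : hilbertType R) (x_ : nat -> X) (x : X) :
    Prop :=
  forall z, inner (x_ n) z @[n --> \oo] --> inner x z.

(* The values of [app] outside [dom] are irrelevant. *)
Record operator (X Y : Type) := Operator { dom : set X ; app :> X -> Y }.

Section Operators.
Context {R : realType} {X : hilbertType R}.
Implicit Types L : operator X X.

Definition linear_operator L : Prop :=
  forall (c : R) x y, dom L x -> dom L y ->
    dom L (c *: x + y) /\ L (c *: x + y) = c *: L x + L y.

Definition closed_operator L : Prop :=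
  closed [set p : X * X | dom L p.1 /\ L p.1 = p.2].

Definition unbounded L : Prop :=
  ~ exists M : R, forall x, dom L x -> `|L x| <= M * `|x|.

(* The right-to-left direction says that L is symmetric, the other one that the
   adjoint of L is a restriction of L. *)
Definition self_adjoint L : Prop :=
  forall y z : X,
    (forall x, dom L x -> inner (L x) y = inner x z) <-> (dom L y /\ L y = z).

Definition strictly_positive L : Prop :=
  (forall x, dom L x -> x != 0 -> 0 < inner (L x) x) /\
  exists2 m0 : R, 0 < m0 & forall x, dom L x -> m0 * `|x| <= `|L x|.

Definition scale_generator L : Prop :=
  [/\ linear_operator L, dense (dom L), closed_operator L,
      unbounded L & self_adjoint L /\ strictly_positive L].

Definition orthogonal_projection (P : X -> X) : Prop :=
  [/\ forall (c : R) x y, P (c *: x + y) = c *: P x + P y,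
      forall x, P (P x) = P x &
      forall x y, inner (P x) y = inner x (P y)].

Definition spectral_family (E : R -> X -> X) : Prop :=
  [/\ forall l, orthogonal_projection (E l),
      forall l m x, E l (E m x) = E (Num.min l m) x,
      forall l x, E m x @[m --> l^'+] --> E l x,
      forall x, E l x @[l --> -oo] --> (0 : X) &
      forall x, E l x @[l --> +oo] --> x].

(* v is the Riemann-Stieltjes integral of f over [a, b] with respect to the
   vector-valued integrator g: the limit, as the mesh goes to 0, of the sums over
   the partitions a = t 0 <= ... <= t n = b with tags xi i in [t i, t (i + 1)]. *)
Definition is_stieltjes (f : R -> R) (g : R -> X) (a b : R) (v : X) : Prop :=
  forall e : R, 0 < e -> exists2 d : R, 0 < d &
    forall (n : nat) (t xi : nat -> R), t 0%N = a -> t n = b ->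
      (forall i, (i < n)%N -> t i <= xi i <= t i.+1 /\ t i.+1 - t i < d) ->
      `|\sum_(i < n) f (xi i) *: (g (t i.+1) - g (t i)) - v| < e.

(* y is the improper integral over the real line of f(l) dE_l x; the vectors x
   for which it converges form the domain of the operator that is the integral of
   f with respect to dE. *)
Definition is_spectral_integral (E : R -> X -> X) (f : R -> R) (x y : X) :
    Prop :=
  exists2 J : R -> R -> X,
    forall a b, a < b -> is_stieltjes f (fun l => E l x) a b (J a b) &
    J p.1 p.2 @[p --> (ninfty_nbhs R, pinfty_nbhs R)] --> y.

Definition resolution_of (L : operator X X) (E : R -> X -> X) : Prop :=
  spectral_family E /\
  forall x y, (dom L x /\ L x = y) <-> is_spectral_integral E id x y.

(* By the spectral theorem a self-adjoint L has exactly one resolution; the zero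
   family only makes the definition total. *)
Definition resolution (L : operator X X) : R -> X -> X :=
  xget (fun _ _ => 0) [set E | resolution_of L E].

(* L^nu. For a scale generator, the resolution vanishes below some m0 > 0, so the
   values of powR at nonpositive arguments play no role. *)
Definition power (L : operator X X) (nu : R) : operator X X :=
  let I := is_spectral_integral (resolution L) (fun l => l `^ nu) in
  Operator [set x | exists y, I x y] (fun x => xget 0 (I x)).

(* For nu < 0 this is all of X, which is a dense subspace of the completion
   that constitutes the member of the scale with index nu. *)
Definition scale_space L (nu : R) : set X := dom (power L nu).

(* The norm of the scale with index nu, with value +oo off the scale space. *)
Definition scale_norm L (nu : R) (x : X) : \bar R :=
  if `[< scale_space L nu x >] then `|power L nu x|%:E else +oo%E.

Context {Y : hilbertType R}.
Implicit Types F : operator X Y.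

Definition unique_solution F (g : Y) (fd : X) : Prop :=
  [/\ dom F fd, F fd = g & forall f, dom F f -> F f = g -> f = fd].

Definition locally_ill_posed F (fd : X) : Prop :=
  forall r' : R, 0 < r' -> exists f_ : nat -> X,
    [/\ forall n, dom F (f_ n),
        forall n, `|f_ n - fd| <= r',
        (0 < limn_einf (fun n => `|f_ n - fd|%:E))%E &
        `|F (f_ n) - F fd| @[n --> \oo] --> (0 : R)].

Definition scale_ball L F (nu mu : R) (fbar : X) : set X :=
  [set f | [/\ scale_space L nu f, (scale_norm L nu (f - fbar)%R <= mu%:E)%E &
               dom F f]].

Definition weak_seq_continuous F : Prop :=
  forall (x_ : nat -> X) (x : X), (forall n, dom F (x_ n)) -> dom F x ->
    weak_cvg x_ x -> weak_cvg (fun n => F (x_ n)) (F x).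

Definition basic_assumption L F (g : Y) (fd : X) (a s u : R) : Prop :=
  [/\ convex_set (dom F) /\ closed (dom F),
      weak_seq_continuous F,
      unique_solution F g fd,
      0 < u /\ scale_space L u fd &
      [/\ 0 <= a, 0 <= s, s < u, u <= 2 * s + a & - a < s]].

Definition index_function (phi : R -> R) : Prop :=
  [/\ phi 0 = 0, {within `[0, +oo[, continuous phi} &
      {in `[0, +oo[ &, {homo phi : t t' / t < t'}}].

Definition concave_function (A : set R) (phi : R -> R) : Prop :=
  convex_function (A : set (convex_lmodType R^o)) (fun t : R^o => - phi t).

Definition conditional_stability L F (fd : X) (a : R)
    (phi : R -> R) (theta rho K : R) (Q : set X) : Prop :=
  [/\ index_function phi /\ concave_function `[0, +oo[ phi,
      0 <= theta, 0 < rho, 0 < K &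
      Q `<=` scale_ball L F theta rho fd /\
      forall f, Q f ->
        (scale_norm L (- a)%R (f - fd)%R <= (K * phi `|F f - F fd|)%:E)%E].

Definition tikhonov L F (s : R) (gdelta : Y) (alpha : R) (f : X) : \bar R :=
  ((2^-1 * `|F f - gdelta| ^+ 2)%:E + alpha%:E * scale_norm L s f ^+ 2)%E.

Definition is_argmin (D : set X) (T : X -> \bar R) (f : X) : Prop :=
  D f /\ forall h, D h -> (T f <= T h)%E.

(* The index j starts at 1, so the truncated subtraction is exact. *)
Definition candidate (r delta : R) (j : nat) : R :=
  delta ^+ 2 * r ^+ (2 * j - 2).

Definition is_candidate_count (r delta : R) (m : nat) : Prop :=
  [/\ (1 <= m)%N, 1 <= candidate r delta m &
      forall j, (1 <= j < m)%N -> candidate r delta j < 1].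

Definition lepskii_index L (s r delta : R) (f_ : R -> X) (m : nat) : nat :=
  \max_(1 <= j < m.+1 | `[< forall i, (1 <= i <= j)%N ->
     (scale_norm L s (f_ (candidate r delta i) - f_ (candidate r delta j))%R
        <= (4 * r ^- (i - 1))%:E)%E >]) j.

Definition psi (phi : R -> R) (u s a t : R) : R :=
  phi (Num.sqrt t) `^ (2 * (u - s) / (a + u)).

Definition bigO_at_0plus (h : R -> \bar R) (k : R -> R) : Prop :=
  exists C : R, \forall delta \near 0^'+, (h delta <= (C * k delta)%:E)%E.

End Operators.

(* Main.v *)
Require Import Defs.
From HB Require Import structures.
From mathcomp Require Import all_boot all_order all_algebra.
From mathcomp Require Import all_classical all_reals all_analysis.
From mathcomp Require Import ring lra.

Set Implicit Arguments.
Unset Strict Implicit.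
Unset Printing Implicit Defensive.

Import Order.TTheory GRing.Theory Num.Theory.
Import numFieldNormedType.Exports.

Local Open Scope classical_set_scope.
Local Open Scope ring_scope.

(** Write h for the difference between a regularized solution f and fd, e for
   its norm of index s and d for the distance between F f and F fd.  Comparing
   the Tikhonov functional at f and at fd bounds alpha e^2 plus half the squared
   residual by delta^2 / 2 + 2 alpha <L^s fd, L^s (- h)>
   ([tikhonov_variational]).  Moving the surplus smoothness of fd to the other
   side, this inner product is at most |fd|_u |h|_(2s-u), and interpolating the
   index 2s-u between -a and s gives the bound
     |fd|_u |h|_(-a)^t e^(1-t)    with  t = (u-s)/(s+a)
   ([power_interpolation]).  Conditional stability replaces |h|_(-a) by
   K phi(d).

   What remains is an inequality between real numbers.  Put
   p = t/(1+t) = (u-s)/(a+u) and tau = delta/sqrt(alpha).  If tau is larger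
   than a fixed multiple of phi(delta)^p, then e <= 2 tau
   ([scalar_error_bound]); concavity of phi controls phi(d) by phi(delta) when d
   is larger than delta.  For the j-th candidate tau is r^(1-j), so these
   candidates are exactly compatible with the thresholds 4 r^(1-i): any two
   regularized solutions with errors 2 r^(1-i) and 2 r^(1-j), i <= j, pass the
   test.  Let j0 be the last index with r^(1-j) at least c phi(delta)^p.  The
   selected index is then at least j0, and passes the test against j0, so that
   its error is at most 6 r^(1-j0) ([lepskii_error]).  Either j0 + 1 violates
   the defining inequality, and r^(1-j0) < r c phi(delta)^p, or j0 = m, and
   r^(1-m) <= delta, which concavity of phi and p <= 1 bound by a multiple of
   phi(delta)^p ([last_good_index], [last_candidate]).

   The powers of L are handled without the spectral theorem.  If L has no
   resolution, the chosen family is 0; this family too consists of orthogonal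
   projections with E_l E_m = E_min(l,m) that converge at both ends, and nothing
   else is used.  Estimates for the powers are obtained for Riemann sums over
   tagged partitions, where they are finite computations with mutually
   orthogonal vectors, and then pass to the limit along one filter on tagged
   partitions ([exhausting]).  The inclusion of the space of index u in the one
   of index s comes from a similar computation: the Riemann sums for
   l^s = (l^u)^(s/u) are uniformly Hoelder continuous functions of those for l^u
   ([sqr_norm_diff_powR]), hence converge whenever the latter do. *)

(** * Powers of nonnegative real numbers *)

Section RealPowers.
Context {R : realType}.
Implicit Types (x y q t : R).

Lemma weighted_amgm t x y : 0 <= t <= 1 -> 0 <= x -> 0 <= y ->
  x `^ t * y `^ (1 - t) <= t * x + (1 - t) * y.
Proof.
move=> /andP[]; rewrite le_eqVlt => /predU1P[<- _ x0 y0|t0].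
  by rewrite powRr0 subr0 powRr1// mul0r add0r.
rewrite le_eqVlt => /predU1P[-> x0 y0|t1 x0 y0].
  by rewrite subrr powRr0 powRr1// mul0r addr0 mul1r mulr1.
have t'0 : 0 < 1 - t by rewrite subr_gt0.
have := @conjugate_powR _ (x `^ t) (y `^ (1 - t)) t^-1 (1 - t)^-1.
rewrite !powR_ge0 !invr_gt0 !invrK -!powRrM !divff ?gt_eqF// !powRr1//.
rewrite (mulrC x) (mulrC y); apply => //.
by rewrite addrC subrK.
Qed.

(** Hoelder's inequality with the exponents 1/t and 1/(1-t): after normalizing
   both sums to 1 it is the weighted arithmetic-geometric mean inequality
   summed over the indices. Allowing t = 0 and t = 1 covers the borderline
   cases of the interpolation between Hilbert scale norms. *)
Lemma holder_sum (I : finType) (x y : I -> R) t : 0 <= t <= 1 ->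
  (forall i, 0 <= x i) -> (forall i, 0 <= y i) ->
  \sum_i x i `^ t * y i `^ (1 - t) <=
  (\sum_i x i) `^ t * (\sum_i y i) `^ (1 - t).
Proof.
move=> /andP[]; rewrite le_eqVlt => /predU1P[<- _ x0 y0|t0].
  rewrite powRr0 subr0 powRr1 ?sumr_ge0// mul1r.
  by apply: ler_sum => i _; rewrite powRr0 mul1r powRr1.
rewrite le_eqVlt => /predU1P[-> x0 y0|t1 x0 y0].
  rewrite subrr powRr0 powRr1 ?sumr_ge0// mulr1.
  by apply: ler_sum => i _; rewrite powRr0 mulr1 powRr1.
have t'0 : 0 < 1 - t by rewrite subr_gt0.
set X := \sum_i x i; set Y := \sum_i y i.
have X0 : 0 <= X by exact: sumr_ge0.
have Y0 : 0 <= Y by exact: sumr_ge0.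
have [X0'|Xn0] := eqVneq X 0.
  rewrite big1 ?mulr_ge0 ?powR_ge0// => i _.
  have /eqP := X0'; rewrite psumr_eq0// => /allP/(_ i (mem_index_enum _)).
  by move=> /eqP ->; rewrite powR0 ?mul0r ?gt_eqF.
have [Y0'|Yn0] := eqVneq Y 0.
  rewrite big1 ?mulr_ge0 ?powR_ge0// => i _.
  have /eqP := Y0'; rewrite psumr_eq0// => /allP/(_ i (mem_index_enum _)).
  by move=> /eqP ->; rewrite (@powR0 _ (1 - t)) ?mulr0 ?gt_eqF.
apply: (@le_trans _ _ (\sum_i X `^ t * Y `^ (1 - t) *
    (t * (x i / X) + (1 - t) * (y i / Y)))).
  apply: ler_sum => i _.
  rewrite -[x i in leLHS](@divfK _ X)// -[y i in leLHS](@divfK _ Y)//.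
  rewrite (@powRM _ (x i / X)) ?(@powRM _ (y i / Y)) ?divr_ge0//.
  rewrite mulrACA mulrC.
  rewrite ler_wpM2l ?mulr_ge0 ?powR_ge0//.
  by apply: weighted_amgm; rewrite ?divr_ge0// (ltW t0) (ltW t1).
rewrite -mulr_sumr big_split/= -!mulr_sumr -!mulr_suml -/X -/Y.
by rewrite !divff// !mulr1 [t + _]addrC subrK mulr1.
Qed.

Lemma sqr_powR x t : 0 <= x -> (x `^ t) ^+ 2 = (x ^+ 2) `^ t.
Proof.
by move=> x0; rewrite -[LHS]powR_mulrn ?powR_ge0// powRAC powR_mulrn.
Qed.

Lemma cauchy_schwarz_sum (I : finType) (x y : I -> R) :
  (forall i, 0 <= x i) -> (forall i, 0 <= y i) ->
  \sum_i x i * y i <=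
  Num.sqrt (\sum_i x i ^+ 2) * Num.sqrt (\sum_i y i ^+ 2).
Proof.
move=> x0 y0; have half : 1 - 2^-1 = 2^-1 :> R by lra.
have half01 : 0 <= (2^-1 : R) <= 1 by lra.
have := holder_sum half01 (fun i => sqr_ge0 (x i)) (fun i => sqr_ge0 (y i)).
rewrite half !powR12_sqrt; last 2 first.
- by apply: sumr_ge0 => i _; exact: sqr_ge0.
- by apply: sumr_ge0 => i _; exact: sqr_ge0.
apply: le_trans; apply: ler_sum => i _.
by rewrite !powR12_sqrt ?sqr_ge0// !sqrtr_sqr !ger0_norm.
Qed.

(** Subadditivity of the q-th power, for q <= 1: if y <= x then y/x and
   (x-y)/x are at most their own q-th powers, and they add up to 1. *)
Lemma sub_powR_le q x y : 0 <= q <= 1 -> 0 <= x -> 0 <= y ->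
  `|x `^ q - y `^ q| <= `|x - y| `^ q.
Proof.
move=> /andP[q0 q1]; wlog xy : x y / y <= x.
  move=> H x0 y0; have [yx|xy] := leP y x; first exact: H.
  by rewrite distrC (distrC x); apply: H => //; exact: ltW.
move=> x0 y0; have [->|yx] := eqVneq y x.
  by rewrite !subrr normr0 powR_ge0.
have {yx}x1 : 0 < x - y by rewrite subr_gt0 lt_neqAle yx.
have {}x0 : 0 < x by rewrite (lt_le_trans x1)// gerBl.
rewrite (ger0_norm (ltW x1)) ger0_norm; last first.
  by rewrite subr_ge0 ge0_ler_powR// nnegrE ltW.
rewrite lerBlDr.
(* x `^ q * (v / x) is linear in v and lies below v `^ q on [0, x] *)
have xq (v : R) : 0 <= v <= x -> x `^ q * (v / x) <= v `^ q.
  move=> /andP[v0 vx]; rewrite -[v in leRHS](@divfK _ x) ?gt_eqF//.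
  rewrite powRM ?divr_ge0 ?(ltW x0)// mulrC ler_wpM2r ?powR_ge0//.
  have [->|vn0] := eqVneq v 0; first by rewrite mul0r powR_ge0.
  have v1 : 0 < v by rewrite lt_neqAle eq_sym vn0.
  by apply: ger1_powR => //; rewrite divr_gt0//= ler_pdivrMr// mul1r.
apply: le_trans (lerD (xq (x - y) _) (xq y _)); last 2 first.
- by rewrite (ltW x1) gerBl.
- by rewrite y0.
by rewrite -mulrDr -mulrDl subrK divff ?gt_eqF// mulr1.
Qed.

Lemma powR_lt_modulus q (e : R) : 0 < q -> 0 < e ->
  exists2 d : R, 0 < d & forall x, 0 <= x < d -> x `^ q < e.
Proof.
move=> q0 e0; exists (e `^ q^-1); first exact: powR_gt0.
move=> x /andP[x0 xd].
rewrite -[ltRHS](@powRr1 _ e) ?(ltW e0)// -(mulVf (lt0r_neq0 q0)) powRrM.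
by apply: gt0_ltr_powR; rewrite ?nnegrE ?powR_ge0.
Qed.

(** The powers are taken at limits that may be 0, where continuity does not
   follow from differentiability; Hoelder continuity covers this case. *)
Lemma cvg_powR (T : Type) (G : set_system T) (FG : Filter G) (f : T -> R)
    (l q : R) :
  0 <= q <= 1 -> (forall i, 0 <= f i) -> 0 <= l ->
  f @ G --> l -> (f i) `^ q @[i --> G] --> l `^ q.
Proof.
move=> /andP[q0 q1] f0 l0 fl; move: (q0); rewrite le_eqVlt => /predU1P[<-|qp].
  under eq_fun do rewrite powRr0.
  by rewrite powRr0; exact: cvg_cst.
apply/cvgrPdist_lt => e e0.
have [d d0 de] := powR_lt_modulus qp e0.
move/cvgrPdist_lt : fl => /(_ _ d0); apply: filterS => i lfi.
by rewrite (le_lt_trans (sub_powR_le _ _ _))// ?q0// de// normr_ge0.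
Qed.

End RealPowers.

(** * Inner products and orthogonal families *)

Section InnerProduct.
Context {R : realType} {X : hilbertType R}.
Implicit Types (x y z : X) (c : R).

Lemma innerDl x y z : inner (x + y) z = inner x z + inner y z.
Proof. by have := inner_linearl 1 x y z; rewrite scale1r mul1r. Qed.

Lemma inner0l z : inner 0 z = 0.
Proof. by apply: (addrI (inner 0 z)); rewrite -innerDl !addr0. Qed.

Lemma innerZl c x z : inner (c *: x) z = c * inner x z.
Proof. by have := inner_linearl c x 0 z; rewrite inner0l !addr0. Qed.

Lemma innerBl x y z : inner (x - y) z = inner x z - inner y z.
Proof. by rewrite innerDl -scaleN1r innerZl mulN1r. Qed.

Lemma innerDr x y z : inner x (y + z) = inner x y + inner x z.
Proof. by rewrite innerC innerDl !(innerC x). Qed.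

Lemma inner0r x : inner x 0 = 0.
Proof. by rewrite innerC inner0l. Qed.

Lemma innerZr c x y : inner x (c *: y) = c * inner x y.
Proof. by rewrite innerC innerZl innerC. Qed.

Lemma innerBr x y z : inner x (y - z) = inner x y - inner x z.
Proof. by rewrite innerC innerBl !(innerC x). Qed.

Lemma inner_suml (I : finType) (p : I -> X) z :
  inner (\sum_i p i) z = \sum_i inner (p i) z.
Proof.
by apply: (big_morph (inner^~ z)) => [x y|]; [exact: innerDl|exact: inner0l].
Qed.

Lemma inner_sumr (I : finType) (p : I -> X) z :
  inner z (\sum_i p i) = \sum_i inner z (p i).
Proof. by rewrite innerC inner_suml; under eq_bigr do rewrite innerC. Qed.

Lemma sqr_normD x y : `|x + y| ^+ 2 = `|x| ^+ 2 + 2 * inner x y + `|y| ^+ 2.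
Proof. by rewrite -!inner_norm innerDl !innerDr (innerC y x); ring. Qed.

Lemma sqr_normB x y : `|x - y| ^+ 2 = `|x| ^+ 2 - 2 * inner x y + `|y| ^+ 2.
Proof. by rewrite -!inner_norm !(innerBl, innerBr) (innerC y x); ring. Qed.

Lemma cauchy_schwarz x y : `|inner x y| <= `|x| * `|y|.
Proof.
have [->|y0] := eqVneq y 0; first by rewrite inner0r !normr0 mulr0.
have Y0 : 0 < `|y| by rewrite normr_gt0.
have : 0 <= inner (`|y| ^+ 2 *: x - inner x y *: y)
                  (`|y| ^+ 2 *: x - inner x y *: y).
  by rewrite inner_norm sqr_ge0.
rewrite !(innerBl, innerBr, innerZl, innerZr) (innerC y x) !inner_norm.
set Z := inner x y; set A := `|x|; set B := `|y|.
rewrite (_ : _ - _ = B ^+ 2 * ((A * B) ^+ 2 - Z ^+ 2)); last by ring.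
rewrite pmulr_rge0 ?exprn_gt0// subr_ge0 -(real_normK (num_real Z)).
by rewrite ler_sqr// nnegrE mulr_ge0 ?normr_ge0.
Qed.

Lemma cvg_inner (T : Type) (G : set_system T) (FG : Filter G)
    (f h : T -> X) x y :
  f @ G --> x -> h @ G --> y -> inner (f t) (h t) @[t --> G] --> inner x y.
Proof.
move=> fx hy.
have innerE (v w : X) :
    inner v w = 2^-1 * (`|v + w| ^+ 2 - `|v| ^+ 2 - `|w| ^+ 2).
  by rewrite sqr_normD; field.
rewrite innerE; under eq_fun do rewrite innerE.
apply: cvgM; first exact: cvg_cst.
have cvg_sqr v_ v : v_ @ G --> v -> `|v_ t : X| ^+ 2 @[t --> G] --> `|v| ^+ 2.
  by move=> vv; rewrite expr2; under eq_fun do rewrite expr2; apply: cvgM;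
    exact: cvg_norm.
by apply: cvgB; [apply: cvgB|]; apply: cvg_sqr => //; exact: cvgD.
Qed.

End InnerProduct.

Section OrthogonalFamilies.
Context {R : realType} {X : hilbertType R}.

Lemma inner_sum_biorthogonal (I : finType) (p w : I -> X) (c d : I -> R) :
  (forall i j, i != j -> inner (p i) (w j) = 0) ->
  inner (\sum_i c i *: p i) (\sum_i d i *: w i) =
  \sum_i c i * d i * inner (p i) (w i).
Proof.
move=> pw; rewrite inner_suml; apply: eq_bigr => i _.
rewrite inner_sumr (bigD1 i)//= big1 ?addr0.
  by rewrite innerZl innerZr mulrA.
by move=> j ji; rewrite innerZl innerZr pw 1?eq_sym// !mulr0.
Qed.

Lemma sqr_norm_sum_orthogonal (I : finType) (p : I -> X) (c : I -> R) :
  (forall i j, i != j -> inner (p i) (p j) = 0) ->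
  `|\sum_i c i *: p i| ^+ 2 = \sum_i (c i * `|p i|) ^+ 2.
Proof.
move=> pp; rewrite -inner_norm inner_sum_biorthogonal//.
by apply: eq_bigr => i _; rewrite inner_norm; ring.
Qed.

Context (I J : finType) (p : I -> X) (p' : J -> X).
Hypothesis p_orth : forall i j, i != j -> inner (p i) (p j) = 0.
Hypothesis p'_orth : forall i j, i != j -> inner (p' i) (p' j) = 0.
Hypothesis sum_eq : \sum_i p i = \sum_k p' k.

(** Two resolutions of one vector into orthogonal parts need no common
   refinement: the numbers <p_i, p'_k> have the marginals |p_i|^2 and
   |p'_k|^2, and play the part of the measures of the intersections of the
   cells of two partitions. *)
Lemma sqr_norm_diff_orthogonal (c : I -> R) (d : J -> R) :
  `|\sum_i c i *: p i - \sum_k d k *: p' k| ^+ 2 =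
  \sum_i \sum_k (c i - d k) ^+ 2 * inner (p i) (p' k).
Proof.
have margin i : `|p i| ^+ 2 = \sum_k inner (p i) (p' k).
  rewrite -inner_sumr -sum_eq inner_sumr (bigD1 i)//= big1 ?addr0 ?inner_norm//.
  by move=> j ji; rewrite p_orth// eq_sym.
have margin' k : `|p' k| ^+ 2 = \sum_i inner (p i) (p' k).
  rewrite -inner_suml sum_eq inner_suml (bigD1 k)//= big1 ?addr0 ?inner_norm//.
  by move=> j ji; rewrite p'_orth.
rewrite sqr_normB !sqr_norm_sum_orthogonal//.
have -> : \sum_i (c i * `|p i|) ^+ 2 =
          \sum_i \sum_k c i ^+ 2 * inner (p i) (p' k).
  by apply: eq_bigr => i _; rewrite exprMn margin mulr_sumr.
have -> : \sum_k (d k * `|p' k|) ^+ 2 =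
          \sum_i \sum_k d k ^+ 2 * inner (p i) (p' k).
  rewrite exchange_big; apply: eq_bigr => k _.
  by rewrite exprMn margin' mulr_sumr.
rewrite inner_suml mulr_sumr -sumrB -big_split/=; apply: eq_bigr => i _.
rewrite inner_sumr mulr_sumr -sumrB -big_split/=; apply: eq_bigr => k _.
by rewrite innerZl innerZr; ring.
Qed.

(* holds for p_i = P_i x and p'_k = P'_k x with commuting projections *)
Hypothesis pp'_ge0 : forall i k, 0 <= inner (p i) (p' k).

(** With <p_i, p'_k> >= 0 as weights, this is |c^q - d^q| <= |c - d|^q followed
   by Hoelder's inequality. It makes the vector with coefficients c^q a
   Hoelder continuous function of the vector with coefficients c, uniformly
   over all resolutions of the same vector. *)
Lemma sqr_norm_diff_powR (c : I -> R) (d : J -> R) (q : R) : 0 <= q <= 1 ->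
  (forall i, 0 <= c i) -> (forall k, 0 <= d k) ->
  `|\sum_i c i `^ q *: p i - \sum_k d k `^ q *: p' k| ^+ 2 <=
  (`|\sum_i c i *: p i - \sum_k d k *: p' k| ^+ 2) `^ q *
  (`|\sum_i p i| ^+ 2) `^ (1 - q).
Proof.
move=> q01 c0 d0; rewrite !sqr_norm_diff_orthogonal.
have -> : `|\sum_i p i| ^+ 2 = \sum_i \sum_k inner (p i) (p' k).
  rewrite -inner_norm {2}sum_eq inner_suml.
  by apply: eq_bigr => i _; rewrite inner_sumr.
rewrite !pair_bigA/=; apply: le_trans (holder_sum q01 _ _); last 2 first.
- by move=> [i k]/=; rewrite mulr_ge0 ?sqr_ge0.
- by move=> [i k]/=.
apply: ler_sum => -[i k] _ /=.
rewrite powRM ?sqr_ge0// -mulrA -powRD; last first.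
  by rewrite addrC subrK oner_eq0.
rewrite (addrC q) subrK powRr1// ler_wpM2r//.
have -> : ((c i - d k) ^+ 2) `^ q = (`|c i - d k| `^ q) ^+ 2.
  by rewrite sqr_powR ?normr_ge0// real_normK ?num_real.
rewrite -(real_normK (num_real (_ - _ : R))) ler_sqr ?nnegrE ?powR_ge0//.
exact: sub_powR_le.
Qed.

End OrthogonalFamilies.

(** * Increasing families of projections and Riemann sums *)

Lemma sum_option (V : zmodType) (I : finType) (f : option I -> V) :
  \sum_o f o = f None + \sum_i f (Some i).
Proof.
rewrite (bigD1 None)//= (reindex_omap Some id)/=; last by case.
by congr (_ + _); apply: eq_bigl => i; rewrite eqxx.
Qed.

Record tagging (R : realType) :=
  Tagging { pieces : nat; node : nat -> R; tagpt : nat -> R }.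

Section IncreasingProjections.
Context {R : realType} {X : hilbertType R}.

(** The part of the notion of spectral family that the zero family shares, so
   that an operator without a resolution is no special case. *)
Definition increasing_projections (E : R -> X -> X) : Prop :=
  (forall l, orthogonal_projection (E l)) /\
  (forall l m x, E l (E m x) = E (Num.min l m) x).

Context (E : R -> X -> X).
Hypothesis hE : increasing_projections E.
Implicit Types (a b c d l : R) (x y : X) (tp : tagging R).

(** The projection onto the spectral subspace of the interval ]a, b]. *)
Definition incr a b x := E b x - E a x.

Let E_lin l c x y : E l (c *: x + y) = c *: E l x + E l y.
Proof. by case: (hE.1 l). Qed.

Lemma projB l x y : E l (x - y) = E l x - E l y.
Proof. by rewrite -scaleN1r addrC E_lin scaleN1r addrC. Qed.

Lemma incrZD a b c x y : incr a b (c *: x + y) = c *: incr a b x + incr a b y.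
Proof. by rewrite /incr !E_lin scalerBr opprD addrACA. Qed.

Lemma incrB a b x y : incr a b (x - y) = incr a b x - incr a b y.
Proof. by rewrite -scaleN1r addrC incrZD scaleN1r addrC. Qed.

Lemma incr_sym a b x y : inner (incr a b x) y = inner x (incr a b y).
Proof.
have Esym l : inner (E l x) y = inner x (E l y) by case: (hE.1 l).
by rewrite innerBl innerBr !Esym.
Qed.

Lemma incr_comp a b c d x : incr a b (incr c d x) =
  E (Num.min b d) x - E (Num.min b c) x
  - (E (Num.min a d) x - E (Num.min a c) x).
Proof. by rewrite /incr !projB !hE.2. Qed.

Lemma incrC a b c d x : incr a b (incr c d x) = incr c d (incr a b x).
Proof.
rewrite !incr_comp (minC d b) (minC d a) (minC c b) (minC c a) !opprB.
by rewrite addrACA [RHS]addrACA [- _ - _ in RHS]addrC.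
Qed.

Lemma incr_sub a b c d x : a <= c -> c <= d -> d <= b ->
  incr a b (incr c d x) = incr c d x.
Proof.
move=> ac cd db; rewrite incr_comp (min_r db) (min_r (le_trans cd db)).
by rewrite (min_l ac) (min_l (le_trans ac cd)) subrr subr0.
Qed.

Lemma incr_disjoint a b c d x : a <= b -> b <= c -> c <= d ->
  incr a b (incr c d x) = 0.
Proof.
move=> ab bc cd; rewrite incr_comp (min_l bc) (min_l (le_trans bc cd)).
rewrite (min_l (le_trans ab bc)) (min_l (le_trans ab (le_trans bc cd))).
by rewrite !subrr.
Qed.

Definition nondecreasing_nodes (tp : tagging R) :=
  forall i, (i < pieces tp)%N -> node tp i <= node tp i.+1.

Lemma node_le tp i j : nondecreasing_nodes tp ->
  (i <= j)%N -> (j <= pieces tp)%N -> node tp i <= node tp j.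
Proof.
move=> tpn; elim: j => [|j IH]; first by rewrite leqn0 => /eqP ->.
rewrite leq_eqVlt => /predU1P[->//|ij jn].
by rewrite (le_trans (IH ij (ltnW jn)))// tpn.
Qed.

Definition whole_incr tp x := incr (node tp 0) (node tp (pieces tp)) x.

(** The spectral subspaces of the cells of a partition, completed by the
   orthogonal complement of their sum. With this extra index the parts of x
   add up to x itself for every partition, and Riemann sums over different
   intervals become comparable. *)
Definition piece tp (o : option 'I_(pieces tp)) x : X :=
  if o is Some i then incr (node tp i) (node tp i.+1) x
  else x - whole_incr tp x.

Lemma piece_sym tp o x y : inner (@piece tp o x) y = inner x (piece o y).
Proof.
case: o => [i|] /=; first exact: incr_sym.
by rewrite innerBl innerBr [inner (whole_incr _ _) _]incr_sym.
Qed.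

Lemma pieceC tp tp' (o : option 'I_(pieces tp))
    (o' : option 'I_(pieces tp')) x :
  piece o (piece o' x) = piece o' (piece o x).
Proof.
have incrBC a b c d y :
    incr a b (y - incr c d y) = incr a b y - incr c d (incr a b y).
  by rewrite incrB incrC.
case: o o' => [i|] [j|] /=; rewrite /whole_incr.
- exact: incrC.
- exact: incrBC.
- by rewrite incrBC.
rewrite !incrBC (incrC (node tp 0)) !opprB addrACA [RHS]addrACA.
by congr (_ + _); exact: addrC.
Qed.

Section OnePartition.
Variable tp : tagging R.
Hypothesis tp_mono : nondecreasing_nodes tp.
Implicit Types o : option 'I_(pieces tp).

Lemma whole_incr_piece (i : 'I_(pieces tp)) x :
  whole_incr tp (piece (Some i) x) = piece (Some i) x.
Proof. by apply: incr_sub; rewrite ?tp_mono// node_le//= ltnW. Qed.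

Lemma whole_incr_idem x : whole_incr tp (whole_incr tp x) = whole_incr tp x.
Proof. by apply: incr_sub => //; exact: node_le. Qed.

Lemma piece_idem o x : piece o (piece o x) = piece o x.
Proof.
case: o => [i|] /=; first by apply: incr_sub => //; exact: tp_mono.
rewrite [whole_incr tp (_ - _)]incrB -!/(whole_incr tp _).
by rewrite whole_incr_idem subrr subr0.
Qed.

Lemma piece_disjoint o o' x : o != o' -> piece o (piece o' x) = 0.
Proof.
have None_Some (i : 'I_(pieces tp)) y :
    @piece tp None (piece (Some i) y) = 0.
  have := whole_incr_piece i y; rewrite /= => ->; exact: subrr.
case: o o' => [i|] [j|] //; last by move=> _; rewrite pieceC None_Some.
move=> ij; wlog {ij} : i j / (i < j)%N => [H|ij].
  have /orP[|ji] : (i < j)%N || (j < i)%N by rewrite -neq_ltn.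
    exact: H.
  by rewrite pieceC H.
by apply: incr_disjoint; rewrite ?tp_mono ?node_le// ltnW.
Qed.

Lemma inner_piece_disjoint o o' x y : o != o' ->
  inner (piece o x) (piece o' y) = 0.
Proof. by move=> oo'; rewrite piece_sym piece_disjoint// inner0r. Qed.

Lemma sum_piece x : \sum_o @piece tp o x = x.
Proof.
rewrite sum_option /=.
rewrite -(big_mkord xpredT (fun i => E (node tp i.+1) x - E (node tp i) x)).
by rewrite telescope_sumr// subrK.
Qed.

End OnePartition.

(** For commuting projections A and B, <A x, B x> = |A B x|^2. *)
Lemma inner_piece_ge0 tp tp' (o : option 'I_(pieces tp))
    (o' : option 'I_(pieces tp')) x :
  nondecreasing_nodes tp -> nondecreasing_nodes tp' ->
  0 <= inner (piece o x) (piece o' x).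
Proof.
move=> mtp mtp'; rewrite -(piece_idem mtp o) -(piece_idem mtp' o') piece_sym.
rewrite (pieceC o o' (piece o' x)) -piece_sym (pieceC o' o) inner_norm.
exact: sqr_ge0.
Qed.

Definition rsum (f : R -> R) (g : R -> X) (tp : tagging R) : X :=
  \sum_(i < pieces tp) f (tagpt tp i) *: (g (node tp i.+1) - g (node tp i)).

(** The coefficient of the complementary part is 0; since 0 `^ q = 0 for
   q > 0, taking q-th powers of the coefficients preserves this shape. *)
Definition piece_coef (f : R -> R) tp (o : option 'I_(pieces tp)) : R :=
  if o is Some i then f (tagpt tp i) else 0.

Lemma rsum_piece f tp x :
  rsum f (E ^~ x) tp = \sum_o piece_coef f o *: @piece tp o x.
Proof.
by rewrite sum_option scale0r add0r.
Qed.

(** The modulus d is independent of the partitions and of their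
   intervals, so that the estimate survives both the limit of vanishing mesh
   and the limit of growing intervals. *)
Lemma rsum_powR_modulus f (q : R) x : 0 < q <= 1 -> (forall l, 0 <= f l) ->
  forall e, 0 < e -> exists2 d, 0 < d & forall tp tp',
    nondecreasing_nodes tp -> nondecreasing_nodes tp' ->
    `|rsum f (E ^~ x) tp - rsum f (E ^~ x) tp'| < d ->
    `|rsum (fun l => f l `^ q) (E ^~ x) tp
      - rsum (fun l => f l `^ q) (E ^~ x) tp'| < e.
Proof.
move=> /andP[q0 q1] f0 e e0.
set C := (`|x| ^+ 2) `^ (1 - q) + 1.
have C0 : 0 < C by rewrite ltr_wpDl ?powR_ge0.
have [d d0 de] := powR_lt_modulus q0 (divr_gt0 (exprn_gt0 2 e0) C0).
exists (Num.sqrt d); first by rewrite sqrtr_gt0.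
move=> tp tp' mtp mtp' dd.
rewrite -ltr_sqr ?nnegrE ?normr_ge0 ?(ltW e0)//.
have := @sqr_norm_diff_powR _ _ _ _ (fun o => @piece tp o x)
  (fun o => @piece tp' o x) _ _ _ _ (@piece_coef f tp) (@piece_coef f tp') q.
rewrite !sum_piece -!rsum_piece !(ltW q0) q1.
have piece_coefq t o :
    @piece_coef f t o `^ q = piece_coef (fun l => f l `^ q) o.
  by case: o => //=; rewrite powR0 ?gt_eqF.
under eq_bigr do rewrite piece_coefq.
under [in X in _ - X]eq_bigr do rewrite piece_coefq.
rewrite -!rsum_piece => H; apply: (le_lt_trans (H _ _ _ _ _ _ _)) => //.
- by move=> i j ij; exact: inner_piece_disjoint.
- by move=> i j ij; exact: inner_piece_disjoint.
- by move=> o o'; exact: inner_piece_ge0.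
- by case=> /=.
- by case=> /=.
set S := `|rsum f (E^~ x) tp - rsum f (E^~ x) tp'| in dd *.
have S0 : 0 <= S by exact: normr_ge0.
rewrite (@le_lt_trans _ _ ((S ^+ 2) `^ q * C))//.
  by rewrite ler_wpM2l ?powR_ge0// lerDl.
rewrite -ltr_pdivlMr// de// sqr_ge0/=.
by rewrite -(sqr_sqrtr (ltW d0)) ltr_sqr ?nnegrE ?sqrtr_ge0.
Qed.

End IncreasingProjections.

(** * Filters of tagged partitions and spectral integrals *)

Section StieltjesFilters.
Context {R : realType} {X : hilbertType R}.

Definition tagged_partition (a b d : R) (tp : tagging R) : Prop :=
  [/\ node tp 0 = a, node tp (pieces tp) = b &
      forall i, (i < pieces tp)%N -> node tp i <= tagpt tp i <= node tp i.+1 /\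
        node tp i.+1 - node tp i < d].

Lemma tagged_partition_mono a b d tp : tagged_partition a b d tp ->
  nondecreasing_nodes tp.
Proof. by move=> [_ _ H] i /H[/andP[ht th] _]; exact: le_trans th. Qed.

Lemma sub_tagged_partition a b d d' tp : d <= d' ->
  tagged_partition a b d tp -> tagged_partition a b d' tp.
Proof.
by move=> dd [? ? H]; split=> // i /H[? /lt_le_trans]; split=> //; auto.
Qed.

(** Equidistant nodes; since at most one of them is 0, one of the two end
   points of each cell can serve as a nonzero tag. *)
Lemma tagged_partition_exists (a b d : R) : a < b -> 0 < d ->
  exists2 tp, tagged_partition a b d tp &
    forall i, (i < pieces tp)%N -> tagpt tp i != 0.
Proof.
move=> ab d0; have ba : 0 < b - a by rewrite subr_gt0.
set n := (Num.truncn ((b - a) / d)).+1.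
have n0 : 0 < n%:R :> R by rewrite ltr0n.
set w := (b - a) / n%:R; have w0 : 0 < w by rewrite divr_gt0.
pose t i : R := a + i%:R * w.
have tS i : t i.+1 = t i + w by rewrite /t -natr1 mulrDl mul1r addrA.
exists (Tagging n t (fun i => if t i == 0 then t i.+1 else t i)); last first.
  by move=> i _ /=; case: ifPn => // /eqP ti0; rewrite tS ti0 add0r gt_eqF.
split=> /=; first by rewrite /t mul0r addr0.
  by rewrite /t mulrC divfK ?gt_eqF// addrC subrK.
move=> i _; split; last first.
  rewrite tS addrAC subrr add0r ltr_pdivrMr// mulrC -ltr_pdivrMr//.
  exact: truncnS_gt.
by case: ifPn => _; rewrite tS lexx lerDl (ltW w0).
Qed.

(** Convergence along this filter is Riemann-Stieltjes convergence over
   [a, b], so the calculus of limits applies to it. *)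
Definition fine_partitions (a b : R) : set_system (tagging R) :=
  [set P | exists2 d, 0 < d & forall tp, tagged_partition a b d tp -> P tp].

Global Instance fine_partitions_filter a b : Filter (fine_partitions a b).
Proof.
split; first by exists 1.
- move=> P Q [d d0 dP] [d' d'0 dQ]; exists (Num.min d d').
    by rewrite lt_min d0.
  move=> tp h; split.
    by apply: dP; apply: sub_tagged_partition h; rewrite ge_min lexx.
  by apply: dQ; apply: sub_tagged_partition h; rewrite ge_min lexx orbT.
- by move=> P Q PQ [d d0 dP]; exists d => // tp /dP/PQ.
Qed.

Lemma fine_partitions_proper a b : a < b -> ProperFilter (fine_partitions a b).
Proof.
move=> ab; split; last exact: fine_partitions_filter.
move=> [d d0 /=]; have [tp h _] := tagged_partition_exists ab d0.
by move/(_ tp h).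
Qed.

Lemma is_stieltjesP (f : R -> R) (g : R -> X) a b v :
  is_stieltjes f g a b v <-> rsum f g @ fine_partitions a b --> v.
Proof.
split.
  move=> h; apply/cvgrPdist_lt => e /h[d d0 hd].
  exists d => // -[n t xi] [? ? ?].
  by rewrite distrC; exact: (hd n t xi).
move=> /cvgrPdist_lt h e /h[d d0 hd]; exists d => // n t xi ta tb H.
by rewrite distrC; exact: (hd (Tagging n t xi)).
Qed.

Local Notation wide := (filter_prod (ninfty_nbhs R) (pinfty_nbhs R)).

Lemma wide_lt : \forall p \near wide, p.1 < p.2.
Proof.
exists ([set x : R | x < 0], [set x : R | 0 < x]) => /=.
  by split; [exact: nbhs_ninfty_lt|exact: nbhs_pinfty_gt].
by move=> [x y]/= [x0 y0]; exact: lt_trans y0.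
Qed.

(** The two successive limits of an improper Stieltjes integral, vanishing mesh
   and growing interval, as a single filter on tagged partitions. Only nonzero
   tags are admitted: the exponents add up in l^s l^t = l^(s+t) for l <> 0, also
   for negative l where all powers are 1, but not for l = 0. *)
Definition exhausting : set_system (tagging R) :=
  [set P | \forall p \near wide, fine_partitions p.1 p.2
     [set tp | (forall i, (i < pieces tp)%N -> tagpt tp i != 0) -> P tp]].

Global Instance exhausting_filter : ProperFilter exhausting.
Proof.
split.
  rewrite /exhausting/= => h.
  have [p [p12 [d d0]]] := filter_ex (filterI wide_lt h).
  by have [tp h1 h2] := tagged_partition_exists p12 d0; move/(_ tp h1 h2).
split.
- by apply: (@nearW _ wide) => p; exists 1.
- rewrite /exhausting /= => P Q hP hQ.
  apply: filterS (@filterI _ wide _ _ _ hP hQ) => p [hp hq].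
  apply: filterS (@filterI _ (fine_partitions p.1 p.2) _ _ _ hp hq).
  by move=> tp [h1 h2] h; split; [exact: h1|exact: h2].
- rewrite /exhausting /= => P Q PQ; apply: filterS => p.
  by apply: filterS => tp h /h; exact: PQ.
Qed.

Lemma exhausting_tags : \forall tp \near exhausting,
  nondecreasing_nodes tp /\ forall i, (i < pieces tp)%N -> tagpt tp i != 0.
Proof.
rewrite /prop_near1 /exhausting /=; apply: (@nearW _ wide) => p.
exists 1 => // tp /tagged_partition_mono mtp h.
by split.
Qed.

Lemma cvg_exhausting (E : R -> X -> X) f x y : is_spectral_integral E f x y ->
  rsum f (E ^~ x) @ exhausting --> y.
Proof.
move=> [J hJ /cvgrPdist_lt Jy]; apply/cvgrPdist_lt => e e0.
have e2 : 0 < e / 2 by rewrite divr_gt0.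
apply: filterS (filterI wide_lt (Jy _ e2)) => -[a b] /= [ab yJ].
have /is_stieltjesP/cvgrPdist_lt/(_ _ e2) := hJ _ _ ab.
apply: filterS => tp h _; rewrite [e]splitr -(subrK (J a b) y) -addrA.
by rewrite (le_lt_trans (ler_normD _ _))// ltrD.
Qed.

Lemma spectral_integral_unique (E : R -> X -> X) f x y y' :
  is_spectral_integral E f x y -> is_spectral_integral E f x y' -> y = y'.
Proof.
by move=> /cvg_exhausting h /cvg_exhausting h'; exact: (norm_cvg_unique h h').
Qed.

(** If h depends on f in a uniformly continuous way, then h inherits the Cauchy
   property from f. *)
Lemma cvg_modulus (T : Type) (G : set_system T) {FG : ProperFilter G}
    (P : set T) (f h : T -> X) :
  G P -> cvg (f @ G) ->
  (forall e, 0 < e -> exists2 d, 0 < d & forall t t', P t -> P t' ->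
     `|f t - f t'| < d -> `|h t - h t'| < e) ->
  cvg (h @ G).
Proof.
move=> GP /cvg_ex[l /cvgrPdist_lt fl] fh; apply: cauchy_cvg.
apply: cauchy_exP => e e0; have [d d0 de] := fh _ e0.
have Gd : G (P `&` [set t | `|l - f t| < d / 2]).
  by apply: filterI => //; apply: fl; rewrite divr_gt0.
have [t0 [Pt0 lt0]] := filter_ex Gd.
exists (h t0); apply: (@filterS _ G _ _ _ _ Gd) => t [Pt /= ltt].
rewrite -ball_normE /=; apply: de => //.
rewrite [d]splitr -(subrK l (f t0)) -addrA.
by rewrite (le_lt_trans (ler_normD _ _))// ltrD// distrC.
Qed.

End StieltjesFilters.

Section SpectralCalculus.
Context {R : realType} {X : hilbertType R} (E : R -> X -> X).
Hypothesis hE : increasing_projections E.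

Lemma spectral_integralB f x x' y y' :
  is_spectral_integral E f x y -> is_spectral_integral E f x' y' ->
  is_spectral_integral E f (x - x') (y - y').
Proof.
move=> [J hJ Jy] [J' hJ' J'y'].
exists (fun a b => J a b - J' a b); last exact: cvgB.
move=> a b ab; apply/is_stieltjesP.
rewrite (_ : rsum _ _ = rsum f (E ^~ x) \- rsum f (E ^~ x')).
  by apply: cvgB; apply/is_stieltjesP; [exact: hJ|exact: hJ'].
apply/funext => tp /=; rewrite /rsum -sumrB; apply: eq_bigr => i _.
by rewrite -scalerBr; congr (_ *: _); exact: incrB.
Qed.

(** The existence of the integral of f entails that of the integral of f^q,
   without any continuity of f: by [rsum_powR_modulus] the Riemann sums for
   f^q are Cauchy on each interval, and so are then their limits as the
   interval grows. *)
Lemma spectral_integral_powR f q x y : 0 < q <= 1 -> (forall l, 0 <= f l) ->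
  is_spectral_integral E f x y ->
  exists z, is_spectral_integral E (fun l => f l `^ q) x z.
Proof.
move=> q01 f0 [J hJ Jy]; pose fq l := f l `^ q.
have modulus := rsum_powR_modulus hE x q01 f0.
have cvgq a b : a < b -> cvg (rsum fq (E ^~ x) @ fine_partitions a b).
  move=> ab; have FF := fine_partitions_proper ab.
  apply: (@cvg_modulus _ _ _ _ _ (@nondecreasing_nodes R) (rsum f (E ^~ x))).
  - by exists 1 => // tp /tagged_partition_mono.
  - by apply/cvg_ex; exists (J a b); apply/is_stieltjesP; exact: hJ.
  - move=> e /modulus[d d0 hd]; exists d => // tp tp' mtp mtp'; exact: hd.
pose Jq a b := lim (rsum fq (E ^~ x) @ fine_partitions a b).
have hJq a b : a < b -> is_stieltjes fq (fun l => E l x) a b (Jq a b).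
  by move=> /cvgq ?; apply/is_stieltjesP.
suff /cvg_ex[z hz] : cvg (Jq p.1 p.2 @[p --> (ninfty_nbhs R, pinfty_nbhs R)]).
  by exists z; exists Jq.
apply: (cvg_modulus wide_lt (f := fun p => J p.1 p.2)).
  by apply/cvg_ex; exists y.
move=> e e0; have e3 : 0 < e / 3 by rewrite divr_gt0.
have [d d0 hd] := modulus _ e3; have d3 : 0 < d / 3 by rewrite divr_gt0.
exists (d / 3) => // p p' pP p'P Jpp'.
(* one partition that is good for both integrals over the same interval *)
have approx (r : R * R) : r.1 < r.2 -> exists tp, [/\ nondecreasing_nodes tp,
    `|J r.1 r.2 - rsum f (E ^~ x) tp| < d / 3 &
    `|Jq r.1 r.2 - rsum fq (E ^~ x) tp| < e / 3].
  move=> r12; have FF := fine_partitions_proper r12.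
  have /is_stieltjesP/cvgrPdist_lt/(_ _ d3) h := hJ _ _ r12.
  have /is_stieltjesP/cvgrPdist_lt/(_ _ e3) h' := hJq _ _ r12.
  have mono : fine_partitions r.1 r.2 (@nondecreasing_nodes R).
    by exists 1 => // tp /tagged_partition_mono.
  by have [tp [? [? ?]]] := filter_ex (filterI mono (filterI h h')); exists tp.
have [tp [mtp Jtp Jqtp]] := approx _ pP.
have [tp' [mtp' Jtp' Jqtp']] := approx _ p'P.
have tri (u v u' v' : X) (r : R) : `|u - v| < r / 3 -> `|u' - v'| < r / 3 ->
    `|v - v'| < r / 3 -> `|u - u'| < r.
  move=> h1 h2 h3.
  have -> : u - u' = (u - v) + (v - v') - (u' - v').
    by rewrite opprB !addrA subrK subrK.
  rewrite (le_lt_trans (ler_normB _ _))//.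
  have := ler_normD (u - v) (v - v'); lra.
apply: (tri _ _ _ _ _ Jqtp Jqtp'); apply: hd => //.
by apply: (tri _ _ _ _ _ _ _ Jpp'); rewrite distrC.
Qed.

Lemma spectral_integral1 x zm zp :
  E l x @[l --> -oo] --> zm -> E l x @[l --> +oo] --> zp ->
  is_spectral_integral E (fun=> 1) x (zp - zm).
Proof.
move=> hm hp; exists (fun a b => E b x - E a x).
  move=> a b ab; apply/is_stieltjesP.
  apply: cvg_near_cst; exists 1 => // tp [ta tb _].
  rewrite /rsum; under eq_bigr do rewrite scale1r.
  rewrite -(big_mkord xpredT (fun i => E (node tp i.+1) x - E (node tp i) x)).
  by rewrite telescope_sumr// ta tb.
apply: cvgB.
  by apply: cvg_comp hp; exact: cvg_snd.
by apply: cvg_comp hm; exact: cvg_fst.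
Qed.

End SpectralCalculus.

(** * Powers of an operator and interpolation *)

Section PowerOperators.
Context {R : realType} {X : hilbertType R} (L : operator X X).
Implicit Types (x h : X) (nu : R).

Let E := resolution L.

(** Without a resolution of L, E is the zero family. *)
Lemma resolution_projections : increasing_projections E.
Proof.
rewrite /E /resolution; case: xgetP => [E' _ [[hproj hmin _ _ _] _]|_].
  by split.
by split=> // l; split=> *; rewrite ?scaler0 ?addr0 ?inner0l ?inner0r.
Qed.

Lemma resolution_cvg x : cvg (E l x @[l --> -oo]) /\ cvg (E l x @[l --> +oo]).
Proof.
rewrite /E /resolution; case: xgetP => [E' _ [[_ _ _ hm hp] _]|_].
  by split; apply/cvg_ex; eexists; [exact: hm|exact: hp].
by split; exact: is_cvg_cst.
Qed.

Lemma powerP nu x : scale_space L nu x ->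
  is_spectral_integral E (fun l => l `^ nu) x (power L nu x).
Proof. by move=> hx; exact: (xgetPex 0 hx). Qed.

Definition power_rsum nu x (tp : tagging R) : X :=
  rsum (fun l => l `^ nu) (E ^~ x) tp.

Lemma cvg_power nu x : scale_space L nu x ->
  power_rsum nu x @ exhausting --> power L nu x.
Proof. by move=> /powerP; exact: cvg_exhausting. Qed.

Lemma scale_spaceB nu x h : scale_space L nu x -> scale_space L nu h ->
  scale_space L nu (x - h).
Proof.
move=> /powerP hx /powerP hh; exists (power L nu x - power L nu h).
by apply: spectral_integralB => //; exact: resolution_projections.
Qed.

Lemma powerB nu x h : scale_space L nu x -> scale_space L nu h ->
  power L nu (x - h) = power L nu x - power L nu h.
Proof.
move=> hx hh; have := powerP (scale_spaceB hx hh).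
move=> /spectral_integral_unique; apply.
by apply: spectral_integralB; [exact: resolution_projections|exact: powerP|
  exact: powerP].
Qed.

Lemma scale_spaceN nu x : scale_space L nu x -> scale_space L nu (- x).
Proof.
by move=> hx; rewrite -sub0r -(subrr x); do 2?[apply: scale_spaceB => //].
Qed.

Lemma powerN nu x : scale_space L nu x -> power L nu (- x) = - power L nu x.
Proof.
move=> hx; have h0 := scale_spaceB hx hx.
by rewrite -sub0r -(subrr x) powerB// powerB// subrr sub0r.
Qed.

Lemma scale_space0 x : scale_space L 0 x.
Proof.
have [/cvg_ex[zm hm] /cvg_ex[zp hp]] := resolution_cvg x.
exists (zp - zm); under eq_fun do rewrite powRr0.
exact: spectral_integral1.
Qed.

(** For s > 0 this is [spectral_integral_powR] with q = s/u: the identity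
   l^s = (l^u)^(s/u) holds for every real l, including l <= 0. *)
Lemma scale_space_le s u x : 0 <= s -> s < u ->
  scale_space L u x -> scale_space L s x.
Proof.
rewrite le_eqVlt => /predU1P[<- _ _|s0 su]; first exact: scale_space0.
move=> /powerP hx; have u0 : 0 < u by exact: lt_trans su.
have su01 : 0 < s / u <= 1 by rewrite divr_gt0//= ler_pdivrMr// mul1r ltW.
have := spectral_integral_powR resolution_projections su01 _ hx.
move=> [l|z hz]; first exact: powR_ge0.
exists z; move: hz; under eq_fun do rewrite -powRrM mulrC divfK ?gt_eqF//.
by [].
Qed.

Lemma scale_norm_fin nu x : scale_space L nu x ->
  scale_norm L nu x = `|power L nu x|%:E.
Proof. by move=> hx; rewrite /scale_norm asboolT. Qed.

Lemma scale_norm_le_space nu x (c : R) : (scale_norm L nu x <= c%:E)%E ->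
  scale_space L nu x.
Proof. by rewrite /scale_norm; case: ifPn => [/asboolP|]. Qed.

(** On Riemann sums over one partition, <L^s x, L^s h> becomes a sum of
   xi^(2s) <p_i x, p_i h> over the cells with tag xi, and
     2s = u + (- a) t + s (1-t)
   distributes the weight over the three norms; the Cauchy-Schwarz and
   Hoelder inequalities for finite sums conclude. *)
Lemma power_rsum_interpolation (s u a : R) (x h : X) (tp : tagging R)
    (t := (u - s) / (s + a)) (S := fun nu y => power_rsum nu y tp) :
  s < u -> u <= 2 * s + a -> - a < s -> nondecreasing_nodes tp ->
  (forall i, (i < pieces tp)%N -> tagpt tp i != 0) ->
  inner (S s x) (S s h) <= `|S u x| * (`|S (- a) h| `^ t * `|S s h| `^ (1 - t)).
Proof.
move=> su usa sa mtp tag0.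
have hE := resolution_projections.
pose p i y := incr E (node tp i) (node tp i.+1) y.
pose n := pieces tp; pose xi i := tagpt tp i.
have SE nu y : S nu y = \sum_(i < n) xi i `^ nu *: p i y by [].
have orth y z (i j : 'I_n) : i != j -> inner (p i y) (p j z) = 0.
  move=> ij.
  exact: (inner_piece_disjoint hE mtp (o := Some i) (o' := Some j)).
have nS nu y : `|S nu y| ^+ 2 = \sum_(i < n) (xi i `^ nu * `|p i y|) ^+ 2.
  rewrite SE sqr_norm_sum_orthogonal// => i j; exact: orth.
have sa0 : 0 < s + a by lra.
have t01 : 0 <= t <= 1.
  apply/andP; split; first by rewrite divr_ge0 ?subr_ge0 ?ltW.
  by rewrite ler_pdivrMr//; lra.
(* The choice of t: interpolating 2 s - u between - a and s. *)
have expo : 2 * s = u + (- a * t + s * (1 - t)).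
  by rewrite /t; field; rewrite gt_eqF.
pose A i := xi i `^ u * `|p i x|.
pose B i := (xi i `^ (- a) * `|p i h|) ^+ 2.
pose C i := (xi i `^ s * `|p i h|) ^+ 2.
have B0 i : 0 <= B i by exact: sqr_ge0.
have C0 i : 0 <= C i by exact: sqr_ge0.
pose D i : R := Num.sqrt (B i `^ t * C i `^ (1 - t)).
have Dle : \sum_(i < n) D i ^+ 2 <=
    (`|S (- a) h| `^ t * `|S s h| `^ (1 - t)) ^+ 2.
  rewrite [leRHS]exprMn (sqr_powR _ (normr_ge0 _)).
  rewrite (sqr_powR (1 - t) (normr_ge0 _)).
  rewrite !nS.
  under eq_bigr do rewrite sqr_sqrtr ?mulr_ge0 ?powR_ge0//.
  exact: holder_sum.
apply: (@le_trans _ _ (\sum_(i < n) A i * D i)).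
  rewrite !SE inner_sum_biorthogonal; last by move=> i j; exact: orth.
  apply: ler_sum => i _; have xi0 : xi i != 0 by exact: tag0.
  have -> : A i * D i = xi i `^ s * xi i `^ s * (`|p i x| * `|p i h|).
    have -> : D i = xi i `^ (- a * t + s * (1 - t)) * `|p i h|.
      apply: (@pexpIrn _ 2) => //.
      - by rewrite nnegrE sqrtr_ge0.
      - by rewrite nnegrE mulr_ge0 ?powR_ge0.
      rewrite sqr_sqrtr ?mulr_ge0 ?powR_ge0//.
      have h0 nu : 0 <= xi i `^ nu * `|p i h| by rewrite mulr_ge0 ?powR_ge0.
      rewrite /B /C -!sqr_powR// -exprMn; congr (_ ^+ 2).
      rewrite !powRM ?powR_ge0// mulrACA -!powRrM.
      rewrite -!powRD ?xi0 ?implybT//; last first.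
        by rewrite addrC subrK oner_eq0.
      by rewrite (addrC t) subrK powRr1.
    rewrite /A mulrACA -!powRD ?xi0 ?implybT//; congr (_ `^ _ * _).
    by rewrite -expo mulrDl mul1r.
  rewrite ler_wpM2l ?mulr_ge0 ?powR_ge0//.
  exact: le_trans (ler_norm _) (cauchy_schwarz _ _).
apply: (le_trans (cauchy_schwarz_sum _ _)) => [i|i|].
- by rewrite mulr_ge0 ?powR_ge0.
- exact: sqrtr_ge0.
rewrite -nS sqrtr_sqr normr_id ler_wpM2l//.
rewrite -[leRHS]ger0_norm ?mulr_ge0 ?powR_ge0// -sqrtr_sqr.
exact: ler_wsqrtr.
Qed.

Lemma power_interpolation (s u a : R) (x h : X) (t := (u - s) / (s + a)) :
  0 <= s -> s < u -> u <= 2 * s + a -> - a < s ->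
  scale_space L u x -> scale_space L s h -> scale_space L (- a) h ->
  inner (power L s x) (power L s h) <=
  `|power L u x| * (`|power L (- a) h| `^ t * `|power L s h| `^ (1 - t)).
Proof.
move=> s0 su usa sa xu hs ha.
have sa0 : 0 < s + a by lra.
have t01 : 0 <= t <= 1.
  apply/andP; split; first by rewrite divr_ge0 ?subr_ge0 ?ltW.
  by rewrite ler_pdivrMr//; lra.
have t'01 : 0 <= 1 - t <= 1 by lra.
have xs := scale_space_le s0 su xu.
pose S := power_rsum.
rewrite -subr_ge0.
apply: (@cvgr_to_ge _ exhausting _ _ (fun tp =>
    `|S u x tp| * (`|S (- a) h tp| `^ t * `|S s h tp| `^ (1 - t))
    - inner (S s x tp) (S s h tp))).
  apply: cvgB; last by apply: cvg_inner; exact: cvg_power.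
  apply: cvgM; first by apply: cvg_norm; exact: cvg_power.
  by apply: cvgM; apply: cvg_powR => //; apply: cvg_norm; exact: cvg_power.
apply: filterS exhausting_tags => tp [mtp tag0]; rewrite subr_ge0.
exact: power_rsum_interpolation.
Qed.

End PowerOperators.

(** * Concave index functions and the scalar error bound *)

Section ConcaveIndexFunctions.
Context {R : realType} (phi : R -> R).
Hypothesis phi_index : index_function phi.
Implicit Types (x d delta : R).

Lemma index_le x d : 0 <= x -> x <= d -> phi x <= phi d.
Proof.
move=> x0; rewrite le_eqVlt => /predU1P[->//|xd]; apply: ltW.
case: phi_index => _ _; apply => //; rewrite in_itv/= andbT//.
exact: le_trans (ltW xd).
Qed.

Lemma index_gt0 x : 0 < x -> 0 < phi x.
Proof.
case: phi_index => phi0 _ mono x0; rewrite -phi0.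
by apply: mono => //; rewrite in_itv/= andbT// ltW.
Qed.

Lemma index_ge0 x : 0 <= x -> 0 <= phi x.
Proof. by case: phi_index => phi0 _ _ x0; rewrite -phi0 index_le. Qed.

Lemma index_cvg0 : phi x @[x --> 0^'+] --> 0.
Proof.
case: phi_index => phi0 /(continuous_within_itvcyP 0 phi)[_ h] _.
by rewrite phi0 in h.
Qed.

Hypothesis phi_concave : concave_function `[0, +oo[ phi.

(** For d > delta, concavity on [0, d] together with phi 0 = 0 gives
   (delta/d) phi d <= phi delta. *)
Lemma concave_index_scale delta d : 0 < delta -> 0 <= d ->
  phi d <= Num.max 1 (d / delta) * phi delta.
Proof.
move=> delta0 d0; have [ddelta|deltad] := leP d delta.
  rewrite (le_trans (index_le d0 ddelta))// ler_peMl ?le_max ?lexx//.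
  by rewrite index_ge0// ltW.
have {}d0 : 0 < d by exact: lt_trans deltad.
rewrite (@le_trans _ _ (d / delta * phi delta))//; last first.
  by rewrite ler_wpM2r ?index_ge0 ?(ltW delta0)// le_max lexx orbT.
have t0 : 0 <= delta / d by rewrite divr_ge0// ltW.
have t1 : delta / d <= 1 by rewrite ler_pdivrMr// mul1r ltW.
have mem x : 0 <= x -> x \in [set` `[0, +oo[].
  by move=> x0; apply/mem_set; rewrite /= in_itv/= andbT.
have := phi_concave (Itv01 t0 t1) (mem d (ltW d0)) (mem 0 (lexx 0)).
rewrite convRE /= -[conv _ _ _]/(delta / d * d + (1 - delta / d) * 0).
case: phi_index => -> _ _.
rewrite oppr0 !mulr0 !addr0 divfK ?gt_eqF// mulrN lerN2 => h.
rewrite -(ler_pM2l (divr_gt0 delta0 d0)) (le_trans h)// mulrA.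
by rewrite mulrA divfK ?gt_eqF// divff ?gt_eqF// mul1r.
Qed.

End ConcaveIndexFunctions.

Section ErrorBound.
Context {R : realType} (phi : R -> R).
Hypothesis phi_index : index_function phi.
Hypothesis phi_concave : concave_function `[0, +oo[ phi.

(** Here e stands for the error in the norm of index s, D for the residual
   against the noisy data and d for the residual against the exact data.
   Suppose e > 2 tau. Then the noise term is dominated, and the inequality
   for e^2 can be solved for e: e <= H with H = C phi(d)^p. Inserting this
   into the bound for the residual gives d^2 <= 4 delta^2 + 2 alpha H^2, that
   is, with x = max(1, d/delta), x^2 tau^2 <= 4 tau^2 + 2 H^2. On the other
   hand H <= C x phi(delta)^p <= x tau / 2 by concavity and p <= 1. Both
   together give H^2 <= 2 tau^2, which contradicts 2 tau < e <= H. *)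
Lemma scalar_error_bound (M K t delta alpha tau d D e : R)
    (p := t / (1 + t)) (C := (4 * M * K `^ t) `^ (1 + t)^-1) :
  0 <= M -> 0 <= K -> 0 < t <= 1 -> 0 < delta -> 0 < alpha -> 0 < tau ->
  alpha * tau ^+ 2 = delta ^+ 2 ->
  0 <= D -> 0 <= d -> d <= D + delta -> 0 <= e ->
  2^-1 * D ^+ 2 + alpha * e ^+ 2 <= 2^-1 * delta ^+ 2 +
    2 * alpha * (M * ((K * phi d) `^ t * e `^ (1 - t))) ->
  2 * C * phi delta `^ p <= tau -> e <= 2 * tau.
Proof.
move=> M0 K0 /andP[t0 t1] delta0 alpha0 tau0 alphatau D0 d0 dD e0 main hC.
rewrite leNgt; apply/negP => te.
have {}e0 : 0 < e by rewrite (lt_trans _ te)// mulr_gt0.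
have t'0 : 0 <= 1 - t by lra.
have s0 : 0 < 1 + t by lra.
have phid : 0 <= phi d by exact: index_ge0.
have phidelta : 0 <= phi delta by rewrite index_ge0// ltW.
set G := 2 * M * (K * phi d) `^ t.
have G0 : 0 <= G by rewrite mulr_ge0 ?mulr_ge0 ?powR_ge0.
set B := G * e `^ (1 - t).
have {}main : D ^+ 2 + 2 * alpha * e ^+ 2 <= delta ^+ 2 + 2 * alpha * B.
  by move: main; rewrite /B /G; lra.
have e2 : e ^+ 2 = e `^ (1 + t) * e `^ (1 - t).
  rewrite -powRD ?(gt_eqF e0) ?implybT//.
  by rewrite addrACA subrr addr0 -[1 + 1]/(2%:R) powR_mulrn// ltW.
set H := C * phi d `^ p.
have H0 : 0 <= H by rewrite mulr_ge0 ?powR_ge0.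
(* C is chosen to make H the solution of H^2 = 2 G H^(1-t). *)
have HG : 2 * G = H `^ (1 + t).
  rewrite /H powRM ?powR_ge0// /C /p -!powRrM mulVf ?gt_eqF// divfK ?gt_eqF//.
  rewrite powRr1 ?mulr_ge0 ?powR_ge0// /G powRM//; ring.
have eH : e <= H.
  rewrite leNgt; apply/negP => He.
  have : e ^+ 2 <= 2 * B.
    have : 4 * tau ^+ 2 <= e ^+ 2.
      rewrite (_ : 4 * _ = (2 * tau) ^+ 2); last by ring.
      by rewrite ler_sqr ?nnegrE ?mulr_ge0// ltW.
    have := sqr_ge0 D; nra.
  rewrite e2 /B mulrA ler_pM2r ?powR_gt0// HG leNgt => /negP; apply.
  by apply: gt0_ltr_powR; rewrite ?nnegrE// ltW.
have BH : 2 * B <= H ^+ 2.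
  rewrite /B mulrA HG.
  have -> : H ^+ 2 = H `^ (1 + t) * H `^ (1 - t).
    have H1 : 0 < H by exact: lt_le_trans eH.
    rewrite -powRD ?(gt_eqF H1) ?implybT//.
    by rewrite addrACA subrr addr0 -[1 + 1]/(2%:R) powR_mulrn.
  by rewrite ler_wpM2l ?powR_ge0// ge0_ler_powR ?nnegrE// ltW.
set x := Num.max 1 (d / delta).
have x1 : 1 <= x by rewrite le_max lexx.
have Hx : H <= x * tau / 2.
  have hx : phi d `^ p <= x * phi delta `^ p.
    have p01 : 0 <= p <= 1.
      by rewrite divr_ge0 ?(ltW t0) ?(ltW s0)//= ler_pdivrMr//; lra.
    case/andP: p01 => p0 p1; have x0 : 0 <= x by lra.
    rewrite (@le_trans _ _ ((x * phi delta) `^ p))//.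
      apply: ge0_ler_powR => //; first by rewrite nnegrE mulr_ge0.
      exact: concave_index_scale.
    by rewrite powRM// ler_wpM2r ?powR_ge0// ler1_powR.
  have C0 : 0 <= C by exact: powR_ge0.
  have h1 : H <= C * (x * phi delta `^ p) by rewrite ler_wpM2l.
  have h2 : x * (2 * C * phi delta `^ p) <= x * tau by rewrite ler_wpM2l//; lra.
  lra.
have xtau : x ^+ 2 * tau ^+ 2 <= 4 * tau ^+ 2 + 2 * H ^+ 2.
  rewrite /x; case: (leP 1 (d / delta)) => [dl|_]; last first.
    by rewrite expr1n; have := sqr_ge0 tau; have := sqr_ge0 H; lra.
  rewrite -(ler_pM2l alpha0) expr_div_n.
  rewrite (_ : alpha * (d ^+ 2 / delta ^+ 2 * tau ^+ 2) = d ^+ 2); last first.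
    rewrite mulrCA alphatau divfK// expf_neq0// gt_eqF//.
  have : d ^+ 2 <= 2 * D ^+ 2 + 2 * delta ^+ 2.
    have : d ^+ 2 <= (D + delta) ^+ 2.
      by rewrite ler_sqr ?nnegrE// addr_ge0// ltW.
    have := sqr_ge0 (D - delta); lra.
  have : alpha * (2 * B) <= alpha * H ^+ 2 by rewrite ler_pM2l.
  have : 0 <= alpha * e ^+ 2 by rewrite mulr_ge0 ?sqr_ge0// ltW.
  by rewrite mulrDr (mulrCA alpha 4) alphatau; lra.
(* H <= x tau / 2 absorbs 2 H^2 into x^2 tau^2, leaving x^2 <= 8. *)
have H2 : H ^+ 2 <= x ^+ 2 * tau ^+ 2 / 4.
  rewrite (_ : _ / 4 = (x * tau / 2) ^+ 2); last by field.
  by rewrite ler_sqr ?nnegrE// (le_trans H0).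
have : (2 * tau) ^+ 2 < H ^+ 2.
  rewrite ltr_sqr ?nnegrE ?(mulr_ge0 _ (ltW tau0))//; exact: lt_le_trans eH.
have := sqr_ge0 tau; lra.
Qed.

End ErrorBound.

(** * Tikhonov minimizers *)

Section Tikhonov.
Context {R : realType} {X Y : hilbertType R}.
Implicit Types (L : operator X X) (F : operator X Y).

Lemma tikhonov_fin L F s gd alpha f : scale_space L s f ->
  tikhonov L F s gd alpha f =
  (2^-1 * `|F f - gd| ^+ 2 + alpha * `|power L s f| ^+ 2)%:E.
Proof.
by move=> hf; rewrite /tikhonov scale_norm_fin// EFinD EFinM -EFin_expe.
Qed.

(** A minimizer has a finite penalty because some element of the domain has. *)
Lemma argmin_scale_space L F s gd alpha f h : 0 < alpha ->
  is_argmin (dom F) (tikhonov L F s gd alpha) f ->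
  dom F h -> scale_space L s h -> scale_space L s f.
Proof.
move=> alpha0 [_ /[apply]] + hs; rewrite [leRHS]tikhonov_fin//.
rewrite {1}/tikhonov /scale_norm; case: ifPn => [/asboolP//|_].
by rewrite expe2 mulyy gt0_muley ?lte_fin// addey.
Qed.

(** The comparison of the functional at f and at h, with
   |f|_s^2 - |h|_s^2 = |f - h|_s^2 - 2 <h, h - f>_s. *)
Lemma tikhonov_variational L F s gd alpha f h : 0 < alpha ->
  is_argmin (dom F) (tikhonov L F s gd alpha) f ->
  dom F h -> scale_space L s h ->
  2^-1 * `|F f - gd| ^+ 2 + alpha * `|power L s (f - h)| ^+ 2 <=
  2^-1 * `|F h - gd| ^+ 2
  + 2 * alpha * inner (power L s h) (power L s (h - f)).
Proof.
move=> alpha0 fmin hF hs; have fs := argmin_scale_space alpha0 fmin hF hs.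
have := fmin.2 _ hF; rewrite !tikhonov_fin// lee_fin => T.
rewrite !powerB// (sqr_normB (power L s f)) innerBr inner_norm.
rewrite (innerC (power L s f)).
by move: T; lra.
Qed.

End Tikhonov.

(** * The Lepskii choice of the parameter *)

Section Lepskii.
Context {R : realType} {X : hilbertType R} (L : operator X X).

(** All errors up to j0 are at most half the thresholds, hence j0 passes every
   comparison and the selected index is at least j0; being selected, it passes
   the comparison with j0, at the threshold 4 r^(1-j0). *)
Lemma lepskii_error s r delta (f_ : R -> X) w (m j0 : nat) :
  (forall j, scale_space L s (f_ (candidate r delta j))) ->
  scale_space L s w -> (1 <= j0 <= m)%N -> 1 < r ->
  (forall j, (1 <= j <= j0)%N ->
     `|power L s (f_ (candidate r delta j) - w)| <= 2 * r ^- (j - 1)) ->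
  `|power L s (f_ (candidate r delta (lepskii_index L s r delta f_ m)) - w)|
    <= 6 * r ^- (j0 - 1).
Proof.
move=> fs ws /andP[j01 j0m] r1 ferr; rewrite /lepskii_index.
pose f j := f_ (candidate r delta j).
have {}fs j : scale_space L s (f j) by exact: fs.
have normE i j : scale_norm L s (f i - f j) =
    `|power L s (f i - w) - power L s (f j - w)|%:E.
  rewrite scale_norm_fin; last exact: scale_spaceB.
  by rewrite !powerB// opprB addrA subrK.
pose P j := `[< forall i, (1 <= i <= j)%N ->
  (scale_norm L s (f i - f j)%R <= (4 * r ^- (i - 1))%:E)%E >].
have r0 : 0 < r by exact: lt_trans r1.
have Pj0 : P j0.
  apply/asboolP => i /andP[i1 ij0]; rewrite normE lee_fin.
  rewrite (le_trans (ler_normB _ _))//.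
  have h1 : `|power L s (f i - w)| <= 2 * r ^- (i - 1).
    by apply: ferr; rewrite i1.
  have h2 : `|power L s (f j0 - w)| <= 2 * r ^- (j0 - 1).
    by apply: ferr; rewrite j01 leqnn.
  have h3 : r ^- (j0 - 1) <= r ^- (i - 1).
    by rewrite lef_pV2 ?posrE ?exprn_gt0// ler_weXn2l ?leq_sub2r// ltW.
  lra.
set J := \max_(_ <= j < _ | _) j.
have j0J : (j0 <= J)%N.
  by apply: leq_bigmax_seq => //; rewrite mem_index_iota j01 ltnS.
have PJ : P J.
  (* a maximum over an empty range is 0, which is excluded by 1 <= j0 <= J *)
  have : J = 0%N \/ P J.
    rewrite /J; elim/big_ind: _ => [|j k hj hk|j Pj]; [by left| |by right].
    by rewrite /maxn; case: ifP.
  by case=> // J0; move: j0J; rewrite J0 leqNgt j01.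
move/asboolP : PJ => /(_ j0); rewrite j01 j0J => /(_ isT).
rewrite normE lee_fin => h.
have h2 : `|power L s (f j0 - w)| <= 2 * r ^- (j0 - 1).
  by apply: ferr; rewrite j01 leqnn.
rewrite -/(f J) -(subKr (power L s (f j0 - w)) (power L s (f J - w))).
rewrite (le_trans (ler_normB _ _))//; lra.
Qed.

End Lepskii.

(** The variational inequality, interpolation and conditional stability reduce
   the error bound to the scalar one; tau is delta / sqrt alpha. *)
Lemma tikhonov_error (R : realType) (X Y : hilbertType R)
    (L : operator X X) (F : operator X Y) (phi : R -> R)
    (a s u K delta alpha tau : R) (fd f : X) (gd : Y)
    (t := (u - s) / (s + a))
    (C := (4 * `|power L u fd| * K `^ t) `^ (1 + t)^-1) :
  index_function phi -> concave_function `[0, +oo[ phi ->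
  0 <= s -> s < u -> u <= 2 * s + a -> - a < s -> 0 <= K ->
  0 < delta -> 0 < alpha -> 0 < tau -> alpha * tau ^+ 2 = delta ^+ 2 ->
  dom F fd -> scale_space L u fd -> `|F fd - gd| <= delta ->
  is_argmin (dom F) (tikhonov L F s gd alpha) f ->
  (scale_norm L (- a) (f - fd)%R <= (K * phi `|F f - F fd|)%:E)%E ->
  2 * C * phi delta `^ (t / (1 + t)) <= tau ->
  `|power L s (f - fd)| <= 2 * tau.
Proof.
move=> phi_index phi_concave s0 su usa sa K0 delta0 alpha0 tau0 alphatau
  fdF fdu gdelta fmin stab hC.
have fds := scale_space_le s0 su fdu.
have fs := argmin_scale_space alpha0 fmin fdF fds.
have sa0 : 0 < s + a by lra.
have t01 : 0 < t <= 1.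
  by rewrite divr_gt0 ?subr_gt0//= ler_pdivrMr//; lra.
have ha := scale_norm_le_space stab.
have := tikhonov_variational alpha0 fmin fdF fds.
rewrite -(opprB f fd) powerN; last exact: scale_spaceB.
have := power_interpolation s0 su usa sa fdu
  (scale_spaceN (scale_spaceB fs fds)) (scale_spaceN ha).
rewrite -/t !powerN//; last exact: scale_spaceB.
rewrite !normrN => interp var.
apply: (@scalar_error_bound _ phi phi_index phi_concave `|power L u fd| K t
  delta alpha tau `|F f - F fd| `|F f - gd|) => //.
  have -> : F f - F fd = (F f - gd) + (gd - F fd) by rewrite addrA subrK.
  by rewrite (le_trans (ler_normD _ _))// lerD2l distrC.
apply: (le_trans var); rewrite lerD//.
  by rewrite ler_wpM2l// ler_sqr ?nnegrE// ltW.
rewrite ler_wpM2l ?mulr_ge0 ?(ltW alpha0)//.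
apply: (le_trans interp); rewrite ler_wpM2l// ler_wpM2r ?powR_ge0//.
move: stab; rewrite scale_norm_fin// lee_fin => stab.
apply: ge0_ler_powR => //; first by case/andP : t01 => /ltW.
- by rewrite nnegrE normr_ge0.
- by rewrite nnegrE mulr_ge0 ?(index_ge0 phi_index).
Qed.

(** The last index satisfying c <= r^(1-j): either its successor fails, which
   bounds r^(1-j0) by r c, or there is no successor. *)
Lemma last_good_index (R : realType) (r c : R) (m : nat) :
  1 < r -> (1 <= m)%N -> c <= 1 ->
  exists j0, [/\ (1 <= j0 <= m)%N, c <= r ^- (j0 - 1) &
    r ^- (j0 - 1) <= Num.max (r * c) (r ^- (m - 1))].
Proof.
move=> r1 m1 c1; have r0 : 0 < r by exact: lt_trans r1.
pose Q j := [&& (1 <= j)%N, (j <= m)%N & c <= r ^- (j - 1)].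
have exQ : exists j, Q j by exists 1%N; rewrite /Q m1 subnn invr1.
have ubQ j : Q j -> (j <= m)%N by case/and3P.
case: (ex_maxnP exQ ubQ) => j0 /and3P[j01 j0m cj0] maxj.
exists j0; split=> //; first by rewrite j01.
move: j0m; rewrite leq_eqVlt => /predU1P[->|j0m].
  by rewrite le_max lexx orbT.
have : ~~ Q j0.+1 by apply/negP => /maxj; rewrite ltnn.
rewrite /Q j0m /= -ltNge subn1 /= => h.
rewrite le_max; apply/orP; left.
have -> : r ^- (j0 - 1) = r * r ^- j0.
  by rewrite -{2}(subnK j01) addn1 exprS invfM mulrA divff ?gt_eqF// mul1r.
by rewrite ler_pM2l// ltW.
Qed.

(** candidate r delta m = (delta r^(m-1))^2, and the last candidate is at
   least 1. *)
Lemma last_candidate (R : realType) (r delta : R) (m : nat) :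
  1 < r -> 0 < delta -> is_candidate_count r delta m ->
  r ^- (m - 1) <= delta.
Proof.
move=> r1 delta0 [m1 hm _]; have r0 : 0 < r by exact: lt_trans r1.
rewrite -[leLHS]mul1r ler_pdivrMr ?exprn_gt0//.
rewrite -ler_sqr ?nnegrE ?mulr_ge0 ?exprn_ge0 ?(ltW delta0) ?(ltW r0)//.
move: hm; rewrite /candidate expr1n exprMn -exprM.
by rewrite mulnBl mul1n mulnC.
Qed.

Theorem corollary2 (R : realType) (X Y : hilbertType R)
    (F : operator X Y) (L : operator X X) (g : Y) (fd : X) (a s u : R)
    (phi : R -> R) (theta rho K : R) (Q : set X)
    (hX : infinite_dimensional X /\ separable_space X)
    (hY : infinite_dimensional Y /\ separable_space Y)
    (hill : locally_ill_posed F fd)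
    (hL : scale_generator L)
    (hbasic : basic_assumption L F g fd a s u)
    (hstab : conditional_stability L F fd a phi theta rho K Q)
    (gdelta : R -> Y)
    (hgdelta : forall delta, 0 < delta -> `|gdelta delta - g| <= delta)
    (falpha : R -> R -> X)
    (hfalpha : forall delta alpha, 0 < delta -> 0 < alpha ->
       is_argmin (dom F) (tikhonov L F s (gdelta delta) alpha)
         (falpha delta alpha))
    (r : R) (hr : 1 < r)
    (m : R -> nat)
    (hm : forall delta, 0 < delta -> is_candidate_count r delta (m delta))
    (hQ : \forall delta \near 0^'+, forall j, (1 <= j <= m delta)%N ->
       Q (falpha delta (candidate r delta j))) :
  let jLep := fun delta =>
    lepskii_index L s r delta (falpha delta) (m delta) in
  let err := fun delta =>
    scale_norm L s (falpha delta (candidate r delta (jLep delta)) - fd) in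
  bigO_at_0plus err (fun delta => Num.sqrt (psi phi u s a (delta ^+ 2))) /\
  bigO_at_0plus err (fun delta => phi delta `^ ((u - s) / (a + u))).
Proof.
case: hbasic => [_ _ [fdF Ffd _] [u0 fdu] [a0 s0 su usa sa]].
case: hstab => [[phi_index phi_concave] theta0 rho0 K0 [QD stab]] jLep err.
have fds := scale_space_le s0 su fdu.
have r0 : 0 < r by exact: lt_trans hr.
pose p := (u - s) / (a + u); pose t := (u - s) / (s + a).
have sa0 : 0 < s + a by lra.
have au0 : 0 < a + u by lra.
have pE : t / (1 + t) = p.
  by rewrite /t /p; field; rewrite !gt_eqF//; lra.
have p0 : 0 < p by rewrite divr_gt0// subr_gt0.
have p1 : p <= 1 by rewrite ler_pdivrMr//; lra.
pose C := (4 * `|power L u fd| * K `^ t) `^ (1 + t)^-1.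
have C0 : 0 <= C by exact: powR_ge0.
have phi1 : 0 < phi 1 by exact: (index_gt0 phi_index).
pose B := 6 * (r * (2 * C) + phi 1 `^ (- p)).
have main : \forall delta \near 0^'+, (err delta <= (B * phi delta `^ p)%:E)%E.
  have C1 : 0 < (2 * C + 1)^-1 by rewrite invr_gt0; lra.
  (* 2 C phi(delta)^p <= 1 makes the first candidate admissible *)
  have [eta eta0 heta] := powR_lt_modulus p0 C1.
  have small : \forall delta \near 0^'+, `|0 - phi delta| < eta.
    by move: eta eta0 {heta}; apply/cvgrPdist_lt; exact: index_cvg0.
  near=> delta.
  have delta0 : 0 < delta by near: delta; exact: nbhs_right_gt.
  have delta1 : delta <= 1 by near: delta; exact: nbhs_right_le.
  have phid0 : 0 <= phi delta by rewrite (index_ge0 phi_index)// ltW.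
  have phidsmall : 2 * C * phi delta `^ p <= 1.
    have : phi delta `^ p < (2 * C + 1)^-1.
      apply: heta; rewrite phid0/= -(ger0_norm phid0) -normrN -sub0r.
      by near: delta.
    rewrite -[ltRHS]mul1r ltr_pdivlMr; last by lra.
    by have := powR_ge0 (phi delta) p; lra.
  have Qdelta : forall j, (1 <= j <= m delta)%N ->
    Q (falpha delta (candidate r delta j)) by near: delta.
  have cand0 j : 0 < candidate r delta j by rewrite mulr_gt0 ?exprn_gt0.
  have fmin j := hfalpha _ _ delta0 (cand0 j).
  have fs j := argmin_scale_space (cand0 j) (fmin j) fdF fds.
  have [m1 _ _] := hm _ delta0.
  have [j0 [/andP[j01 j0m] good bad]] := last_good_index hr m1 phidsmall.
  rewrite /err scale_norm_fin ?lee_fin; last exact: scale_spaceB.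
  have := @lepskii_error _ _ L s r delta (falpha delta) fd (m delta) j0.
  rewrite j01 j0m => /(_ fs fds isT hr) lep.
  apply: (le_trans (lep _)).
    move=> j /andP[j1 jj0].
    have r1j : 0 < r ^- (j - 1) by rewrite invr_gt0 exprn_gt0.
    apply: (tikhonov_error phi_index phi_concave s0 su usa sa (ltW K0) delta0
      (cand0 j) r1j _ fdF fdu _ (fmin j) _).
    - have -> : candidate r delta j = delta ^+ 2 * (r ^+ (j - 1)) ^+ 2.
        by rewrite /candidate -exprM mulnBl mul1n mulnC.
      by rewrite -mulrA exprVn divff ?mulr1// expf_neq0// expf_neq0// gt_eqF.
    - by rewrite Ffd distrC; exact: hgdelta.
    - by apply: stab; apply: Qdelta; rewrite j1 (leq_trans jj0).
    rewrite pE (le_trans good)// lef_pV2 ?posrE ?exprn_gt0//.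
    by rewrite ler_weXn2l ?leq_sub2r// ltW.
  have -> : B * phi delta `^ p =
      6 * ((r * (2 * C) + phi 1 `^ (- p)) * phi delta `^ p).
    by rewrite /B; ring.
  apply: ler_wpM2l => //; apply: (le_trans bad).
  (* concavity gives delta * phi 1 <= phi delta, and delta <= delta `^ p *)
  have dp : delta <= phi 1 `^ (- p) * phi delta `^ p.
    rewrite powRN mulrC ler_pdivlMr ?powR_gt0//.
    rewrite (@le_trans _ _ (delta `^ p * phi 1 `^ p))//.
      by rewrite ler_wpM2r ?powR_ge0// ger1_powR// delta0.
    rewrite -powRM ?(ltW delta0) ?(ltW phi1)//.
    apply: ge0_ler_powR => //; first exact: ltW.
      by rewrite nnegrE mulr_ge0// ltW.
    have := concave_index_scale phi_index phi_concave delta0 ler01.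
    rewrite max_r ?ler_pdivlMr ?mul1r// => h.
    by rewrite mulrC -ler_pdivlMr// mulrC.
  have rC0 : 0 <= r * (2 * C) * phi delta `^ p.
    by rewrite !mulr_ge0 ?powR_ge0// ltW.
  have w0 : 0 <= phi 1 `^ (- p) * phi delta `^ p by rewrite mulr_ge0 ?powR_ge0.
  have last_le := last_candidate hr delta0 (hm _ delta0).
  by rewrite ge_max; apply/andP; split; lra.
split; exists B; last exact: main.
near=> delta; have delta0 : 0 < delta by near: delta; exact: nbhs_right_gt.
have -> : Num.sqrt (psi phi u s a (delta ^+ 2)) = phi delta `^ p.
  rewrite /psi sqrtr_sqr gtr0_norm// -powR12_sqrt ?powR_ge0// -powRrM.
  by congr (_ `^ _); rewrite /p; field; rewrite gt_eqF.
by near: delta.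
Unshelve. all: by end_near. Qed.
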